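(* Let $k\ge 1$ and $0\le t\le k$ be fixed integers and let $n\ge 1$. Then: (1) $s_{n,t,0}=\sum_{j=0}^{t-1} C_{n,j}$. (2) $s_{n,0,1}=\sum_{j=0}^{k-1} C_{n-1,j}=\frac{k}{n}\binom{(k+1)(n-1)}{n-1}$. (3) For every integer $r$ with $1\le r\le n$, \[ s_{n,t,r}=s_{n,t,r-1}+C_{r,t}\bigl(s_{n-r+1,0,1}-t\,[r=n]\bigr), \] where $[r=n]$ equals $1$ if $r=n$ and $0$ otherwise.
   Context: For a positive integer $k$ and an integer $t$ with $0\le t\le k$, a $k_t$-Dyck path is a lattice path consisting of up-steps $(1,k)$ and down-steps $(1,-1)$ that starts at $(0,0)$, stays weakly above the line $y=-t$, and ends on the line $y=0$; if it has $n$ up-steps it has $kn$ down-steps and length $(k+1)n$. For $n\ge 1$ and $0\le r\le n$, $s_{n,t,r}$ denotes the total number, summed over all $k_t$-Dyck paths with $n$ up-steps, of down-steps lying between the $r$-th and the $(r+1)$-th up-step (for $r=0$: the down-steps before the first up-step; for $r=n$: the down-steps after the last up-step). For integers $n,j\ge 0$ set $C_{n,j}=\frac{j+1}{(k+1)n+j+1}\binom{(k+1)n+j+1}{n}$. *)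

(* Defs.v *)
From HB Require Export structures.
From mathcomp Require Export all_boot all_order all_algebra.

Set Implicit Arguments.
Unset Strict Implicit.
Unset Printing Implicit Defensive.

Export Order.TTheory GRing.Theory Num.Theory.

Local Open Scope ring_scope.

(* A lattice path from (0,0) is its sequence of steps:
   true is the up-step (1,k), false is the down-step (1,-1). *)
Definition step_rise (k : nat) (b : bool) : int := if b then k%:Z else - 1.

Definition height (k : nat) (p : seq bool) : int := \sum_(b <- p) step_rise k b.

Definition kt_dyck (k t : nat) (p : seq bool) : bool :=
  all (fun i => - t%:Z <= height k (take i p)) (iota 0 (size p).+1)
  && (height k p == 0).

Definition up_steps (p : seq bool) : nat := count_mem true p.

(* A down-step lies between the r-th and the (r+1)-th up-step iff exactly r
   up-steps precede it; this also covers r = 0 and r = up_steps p. *)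
Definition down_steps_between (r : nat) (p : seq bool) : nat :=
  count (fun i => ~~ nth true p i && (up_steps (take i p) == r))
        (iota 0 (size p)).

(* A path ending at height 0 with n up-steps has length (k+1)n, so these tuples
   are all the k_t-Dyck paths with n up-steps. *)
Definition kt_dyck_paths (k n t : nat) : {set (k.+1 * n).-tuple bool} :=
  [set p : (k.+1 * n).-tuple bool | kt_dyck k t p & up_steps p == n].

Definition s (k n t r : nat) : nat :=
  (\sum_(p in kt_dyck_paths k n t) down_steps_between r p)%N.

Definition Cnum (k n j : nat) : rat :=
  (j.+1)%:R / (k.+1 * n + j + 1)%:R * ('C(k.+1 * n + j + 1, n))%:R.

(* Main.v *)
Require Import Defs.
From mathcomp Require Import zify ring.

(** Raising heights by t, a k_t-Dyck path runs from t to t and stays weakly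
    above 0.  Let F(m, g) = [first_passage k m g] count the paths with m up-steps that
    start at height g and reach -1 for the first time at their end.  Splitting
    off the first step gives F(m+1, g) = F(m, g+k) + F(m+1, g-1), which the
    closed form C_{m,g} also satisfies.  As t <= k, after the last up-step a
    path from g to -1 has at least t+1 down-steps, so for m > 0 it amounts to a
    path from g to t staying weakly above 0.

    Replacing the starting height t by an arbitrary g, all three identities can
    be proved by induction on the length through the same first-step recursion:
    the number of down-steps before the first up-step is a sum of values F(m, i)
    over i < g, and in (3) the factor C_{r,t} becomes F(r, g). *)

(** The recursion in [g] is unrolled into a sum over the height [i] at which the first up-step is
    taken, which leaves structural recursion on [m]. *)
Fixpoint first_passage (k m g : nat) : nat :=
  if m is m'.+1 then \sum_(i < g.+1) first_passage k m' (i + k) else 1.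

Fixpoint stays_nonneg_to (k t g : nat) (p : seq bool) : bool :=
  match p with
  | [::] => g == t
  | true :: p' => stays_nonneg_to k t (g + k) p'
  | false :: p' => if g is g'.+1 then stays_nonneg_to k t g' p' else false
  end.

(** The arbitrary weight [f] can absorb a removed first step. *)
Definition path_sum (k t L m g : nat) (f : seq bool -> nat) : nat :=
  \sum_(p : L.-tuple bool | stays_nonneg_to k t g p && (up_steps p == m)) f p.

Lemma first_passageS0 k m : first_passage k m.+1 0 = first_passage k m k.
Proof. by rewrite /= big_ord_recr big_ord0. Qed.

Lemma first_passageSS k m g :
  first_passage k m.+1 g.+1
    = first_passage k m (g.+1 + k) + first_passage k m.+1 g.
Proof. by rewrite /= big_ord_recr /= addnC. Qed.

Lemma big_ord_addr (f : nat -> nat) g k :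
  \sum_(i < g + k) f i = \sum_(i < k) f i + \sum_(i < g) f (i + k).
Proof.
rewrite (addnC g k) big_split_ord; congr (_ + _).
by apply: eq_bigr => i _; rewrite /= addnC.
Qed.

(** * Dyck paths as raised paths *)

Lemma height_nil k : height k [::] = 0%R.
Proof. exact: big_nil. Qed.

Lemma height_cons k b p : height k (b :: p) = (step_rise k b + height k p)%R.
Proof. by rewrite /height big_cons. Qed.

Lemma iota0S n : iota 0 n.+1 = 0 :: [seq i.+1 | i <- iota 0 n].
Proof. by rewrite /= (iotaDl 1 0). Qed.

Lemma all_iota0S a n :
  all a (iota 0 n.+1) = a 0 && all (fun i => a i.+1) (iota 0 n).
Proof. by rewrite iota0S -(all_map succn a). Qed.

(** Removing a step moves the start, so the induction needs every [g]; the Dyck condition is the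
    case g = t. *)
Lemma stays_nonneg_toE k t g p :
  stays_nonneg_to k t g p
    = all (fun i => - t%:Z <= g%:Z - t%:Z + height k (take i p))%R
          (iota 0 (size p).+1)
      && (g%:Z - t%:Z + height k p == 0)%R.
Proof.
elim: p g => [|b p IHp] g.
  by rewrite /= height_nil addr0; lia.
rewrite (_ : all _ _ = all (fun i => - t%:Z <=
    g%:Z - t%:Z + (step_rise k b + height k (take i p)))%R (iota 0 (size p).+1));
  last first.
  rewrite all_iota0S height_nil (_ : (- t%:Z <= g%:Z - t%:Z + 0)%R); last lia.
  by rewrite andTb; apply: eq_all => i; rewrite /= height_cons.
rewrite height_cons; case: b; rewrite [stays_nonneg_to _ _ _ _]/= /step_rise.
  rewrite IHp; congr (_ && _); last by rewrite PoszD; lia.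
  by apply: eq_all => i; rewrite PoszD; lia.
case: g => [|g]; first by rewrite /= take0 height_nil; lia.
rewrite IHp; congr (_ && _); last by lia.
by apply: eq_all => i; lia.
Qed.

Lemma kt_dyckE k t p : kt_dyck k t p = stays_nonneg_to k t t p.
Proof.
rewrite stays_nonneg_toE /kt_dyck subrr add0r; congr (_ && _).
by apply: eq_all => i; rewrite add0r.
Qed.

Lemma down_steps_between_cons r b p :
  down_steps_between r (b :: p)
    = if b then (if r is r'.+1 then down_steps_between r' p else 0)
      else (r == 0) + down_steps_between r p.
Proof.
rewrite /down_steps_between [size _]/= iota0S /= (count_map succn).
case: b => /=; last first.
  by rewrite [r == 0]eq_sym; congr (_ + _); apply: eq_count.
case: r => [|r]; last by apply: eq_count.
by rewrite add0n (eq_count (a2 := pred0)) ?count_pred0 // => i;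
  rewrite /= /up_steps /= andbF.
Qed.

(** * Path sums by first step *)

Lemma sum_tupleS L (P : pred (seq bool)) (f : seq bool -> nat) :
  \sum_(p : L.+1.-tuple bool | P p) f p
    = \sum_(p : L.-tuple bool | P (true :: p)) f (true :: p)
      + \sum_(p : L.-tuple bool | P (false :: p)) f (false :: p).
Proof.
rewrite (reindex (fun x : bool * L.-tuple bool => cons_tuple x.1 x.2)) /=.
  rewrite -(pair_big_dep xpredT (fun b (p : L.-tuple bool) => P (b :: p))
             (fun b p => f (b :: p))) /=.
  by rewrite big_bool.
exists (fun p => (thead p, behead_tuple p)) => [[b p] _|p _] /=.
  by congr pair; apply: val_inj.
by rewrite [RHS]tuple_eta; apply: val_inj.
Qed.

Lemma path_sumS k t L m g f :
  path_sum k t L.+1 m g f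
    = (if m is m'.+1 then path_sum k t L m' (g + k) (fun p => f (true :: p))
       else 0)
      + (if g is g'.+1 then path_sum k t L m g' (fun p => f (false :: p))
         else 0).
Proof.
rewrite /path_sum (sum_tupleS L
  (fun p => stays_nonneg_to k t g p && (up_steps p == m)) f).
congr (_ + _).
  case: m => [|m] //; apply: big_pred0 => p.
  by rewrite /up_steps /= andbF.
by case: g => [|g] //; apply: big_pred0.
Qed.

Lemma path_sum0 k t m g f :
  path_sum k t 0 m g f = if (g == t) && (m == 0) then f [::] else 0.
Proof.
rewrite /path_sum big_mkcond (big_pred1 [tuple]) /=.
  by rewrite /up_steps /= [m == 0]eq_sym.
by move=> p; symmetry; apply/eqP; rewrite (tuple0 p).
Qed.

Lemma path_sumD k t L m g f1 f2 :
  path_sum k t L m g (fun p => f1 p + f2 p)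
    = path_sum k t L m g f1 + path_sum k t L m g f2.
Proof. exact: big_split. Qed.

Lemma eq_path_sum k t L m g f1 f2 :
  f1 =1 f2 -> path_sum k t L m g f1 = path_sum k t L m g f2.
Proof. by move=> eqf; apply: eq_bigr => p _. Qed.

Lemma path_sum_const0 k t L m g : path_sum k t L m g (fun=> 0) = 0.
Proof. exact: big1_eq. Qed.

(** * Counting paths and their down-steps *)

Lemma path_count k t L m g : t <= k -> L + t = k.+1 * m + g ->
  path_sum k t L m g (fun=> 1) = first_passage k m g.
Proof.
move=> t_le_k; elim: L m g => [|L IHL] m g eqL.
  (* With [L] zero the length equation reads t = (k+1)m + g, and t <= k forces m = 0. *)
  have m0 : m = 0 by case: m eqL => // m; nia.
  have gt : g = t by lia.
  by rewrite path_sum0 m0 gt eqxx.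
rewrite path_sumS; case: m g eqL => [|m] [|g] eqL; first by lia.
- by rewrite IHL //; lia.
- by rewrite addn0 IHL ?first_passageS0 //; lia.
- by rewrite first_passageSS !IHL //; lia.
Qed.

Lemma path_sum_downsS k t r L m g :
  path_sum k t L.+1 m g (down_steps_between r) =
  (if m is m'.+1 then
     if r is r'.+1 then path_sum k t L m' (g + k) (down_steps_between r') else 0
   else 0)
  + (if g is g'.+1 then
       (r == 0) * path_sum k t L m g' (fun=> 1)
       + path_sum k t L m g' (down_steps_between r)
     else 0).
Proof.
rewrite path_sumS; congr (_ + _).
  case: m => // m; case: r => [|r].
    rewrite -[RHS](path_sum_const0 k t L m (g + k)).
    by apply: eq_path_sum => p; rewrite down_steps_between_cons.
  by apply: eq_path_sum => p; rewrite down_steps_between_cons.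
case: g => // g.
rewrite (eq_path_sum k t L m g _
  (fun p => (r == 0) + down_steps_between r p)); last first.
  by move=> p; rewrite down_steps_between_cons.
rewrite path_sumD; congr (_ + _).
by case: (r == 0); rewrite ?mul1n // mul0n path_sum_const0.
Qed.

(* Without up-steps the path cannot go below its end height t; this is where the
   correction term t [r = n] comes from. *)
Lemma downs_before_first_up k t L m g : t <= k -> L + t = k.+1 * m + g ->
  path_sum k t L m g (down_steps_between 0) + t * (m == 0)
    = \sum_(i < g) first_passage k m i.
Proof.
move=> t_le_k; elim: L m g => [|L IHL] m g eqL.
  have m0 : m = 0 by case: m eqL => // m; nia.
  have gt : g = t by lia.
  rewrite path_sum0 m0 gt eqxx /= muln1 sum_nat_const card_ord muln1.
  by rewrite /down_steps_between.
rewrite path_sum_downsS; case: g eqL => [|g] eqL.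
  rewrite big_ord0; case: m eqL => [|m] eqL; first by lia.
  by rewrite muln0.
(* The top term F(m, g) counts the paths that open with a down-step, one such step each. *)
rewrite big_ord_recr /= -IHL; last by lia.
rewrite path_count //; last by lia.
by case: m {eqL} => [|m]; lia.
Qed.

(** A leading up-step lowers [r] and [m] together and keeps m - r, so both sides recurse as F(r+1,
    g) does. The correction stands on the left to avoid subtraction in [nat]. *)
Lemma downs_between_rec k t L m r g : t <= k ->
  L + t = k.+1 * m.+1 + g -> r <= m ->
  path_sum k t L m.+1 g (down_steps_between r.+1)
    + first_passage k r.+1 g * (t * (r == m))
  = path_sum k t L m.+1 g (down_steps_between r)
    + first_passage k r.+1 g * \sum_(j < k) first_passage k (m - r) j.
Proof.
move=> t_le_k; elim: L m r g => [|L IHL] m r g eqL le_rm; first by nia.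
rewrite !path_sum_downsS; case: r le_rm => [|r] le_rm.
  (* Up to the correction, the up branch is the sum of F(m, i) over i < g + k. The terms i < k form
     the factor in the claim; for g > 0 the others add up to F(m+1, g-1), the number of leading
     down-steps on the right. *)
  have := downs_before_first_up k t L m (g + k) t_le_k.
  rewrite big_ord_addr => H0.
  case: g eqL H0 => [|g] eqL H0.
    have {H0} := H0 ltac:(lia); rewrite big_ord0 [0 == m]eq_sym first_passageS0 subn0 /=.
    by move: (t * _) (\sum_(i < k) _) => A B; lia.
  have {}IHL := IHL m 0 g ltac:(lia) isT.
  have {H0} := H0 ltac:(lia).
  rewrite path_count //; last by lia.
  rewrite [0 == m]eq_sym -/(first_passage k m.+1 g) first_passageSS mulnDl mulnDl.
  by move: IHL; rewrite [0 == m]eq_sym subn0 /=; move: (t * _) (\sum_(i < k) _) => A B; lia.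
case: m eqL le_rm => [|m] eqL le_rm //.
have {}le_rm : r <= m by [].
have {}IHup := IHL m r (g + k) ltac:(lia) le_rm.
case: g eqL IHup => [|g] eqL.
  rewrite first_passageS0 subSS eqSS add0n.
  by move: (t * _) (\sum_(i < k) _) => A B; lia.
have := IHL m.+1 r.+1 g ltac:(lia) le_rm.
rewrite (first_passageSS k r.+1) subSS eqSS !mulnDl.
by move: (t * _) (\sum_(i < k) _) => A B; lia.
Qed.

(** * Closed forms *)

Local Open Scope ring_scope.

Lemma bin_succ_rat n m : (m <= n)%N ->
  'C(n, m.+1)%:R = (n%:R - m%:R) / m.+1%:R * 'C(n, m)%:R :> rat.
Proof.
move=> le_mn; have /(congr1 (fun x => x%:R : rat)) := mul_bin_left n m.
rewrite !natrM natrB // => eqx.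
by rewrite mulrAC -eqx mulrC mulKf // pnatr_eq0.
Qed.

Lemma Cnum_first_passage k m g : (first_passage k m g)%:R = Cnum k m g.
Proof.
elim: m g => [|m IHm] g.
  by rewrite /= /Cnum muln0 add0n addn1 bin0 mulr1 divff // pnatr_eq0.
elim: g => [|g IHg].
  rewrite first_passageS0 IHm /Cnum.
  have -> : (k.+1 * m.+1 + 0 + 1 = (k.+1 * m + k + 1).+1)%N by lia.
  have /(congr1 (fun x => x%:R : rat)) := mul_bin_diag (k.+1 * m + k + 1).+1 m.
  rewrite [_.+1.-1]/= !natrM => eqx.
  have m_neq0 : m.+1%:R != 0 :> rat by rewrite pnatr_eq0.
  apply: (mulfI m_neq0); rewrite [RHS]mulrCA -eqx; field.
  (* The denominators from [field] become casts of naturals, which [lia] shows nonzero. *)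
  by rewrite -[1]mulr1n -!(natrM, natrD) !pnatr_eq0; lia.
rewrite first_passageSS natrD IHm IHg /Cnum.
(* The upper indices are [M], [M] and [M.+1], so Pascal's rule and [bin_succ_rat] leave only
   ['C(M, m)]. *)
set M := (k.+1 * m + (g.+1 + k) + 1)%N.
have -> : (k.+1 * m.+1 + g + 1 = M)%N by lia.
have -> : (k.+1 * m.+1 + g.+1 + 1 = M.+1)%N by lia.
rewrite binS natrD bin_succ_rat; last by lia.
rewrite -(natr1 M) /M; field.
by rewrite -[1]mulr1n -!(natrM, natrD) !pnatr_eq0; lia.
Qed.

(* Telescoping: with p = l - k, the first summand on the right is the coefficient
   of x^(m+1) in B^p, where B = 1 + x B^(k+1), and
   B^p - B^(p-1) = x B^(p+k). *)
Lemma sum_Cnum_telescope k m l :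
  \sum_(j < l) Cnum k m j
    = (l%:R - k%:R) / (k.+1 * m + l + 1)%:R * 'C(k.+1 * m + l + 1, m.+1)%:R
      + k%:R / m.+1%:R * 'C(k.+1 * m, m)%:R :> rat.
Proof.
elim: l => [|l IHl].
  rewrite big_ord0 addn0 addn1.
  have /(congr1 (fun x => x%:R : rat)) := mul_bin_diag (k.+1 * m).+1 m.
  rewrite [_.+1.-1]/= !natrM => eqx.
  have -> : 'C((k.+1 * m).+1, m.+1)%:R
      = (k.+1 * m).+1%:R * 'C(k.+1 * m, m)%:R / m.+1%:R :> rat.
    by rewrite eqx mulrC mulKf // pnatr_eq0.
  field.
  by rewrite -[1]mulr1n -!(natrM, natrD) !pnatr_eq0; lia.
rewrite big_ord_recr /= IHl /Cnum.
set M := (k.+1 * m + l + 1)%N.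
have -> : (k.+1 * m + l.+1 + 1 = M.+1)%N by lia.
rewrite binS natrD bin_succ_rat; last by lia.
rewrite -(natr1 M) /M; field.
by rewrite -[1]mulr1n -!(natrM, natrD) !pnatr_eq0; lia.
Qed.

Lemma sum_Cnum k m :
  \sum_(j < k) Cnum k m j = k%:R / m.+1%:R * 'C(k.+1 * m, m)%:R :> rat.
Proof. by rewrite sum_Cnum_telescope subrr !mul0r add0r. Qed.

(** * The three identities *)

Lemma s_path_sum k n t r :
  s k n t r = path_sum k t (k.+1 * n) n t (down_steps_between r).
Proof.
by apply: eq_bigl => p; rewrite inE kt_dyckE.
Qed.

(** For t = 0 the first step must go up; what remains is to count the down-steps before the first
    up-step of a path from height [k], with zero correction. *)
Lemma s_0_1 k n : (s k n.+1 0 1 = \sum_(j < k) first_passage k n j)%N.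
Proof.
rewrite s_path_sum mulnS path_sum_downsS addn0.
have /= := downs_before_first_up k 0 (k + k.+1 * n) n k (leq0n k).
by rewrite mul0n !addn0 add0n => -> //; lia.
Qed.

Theorem theorem3p1 (k t n : nat) (k_gt0 : (0 < k)%N) (t_le_k : (t <= k)%N)
    (n_gt0 : (0 < n)%N) :
  [/\ (s k n t 0)%:R = \sum_(j < t) Cnum k n j :> rat,
      (s k n 0 1)%:R = \sum_(j < k) Cnum k (n - 1) j :> rat
      /\ \sum_(j < k) Cnum k (n - 1) j
         = k%:R / n%:R * ('C(k.+1 * (n - 1), n - 1))%:R :> rat
    & forall r : nat, (1 <= r <= n)%N ->
        (s k n t r)%:R = (s k n t (r - 1))%:R
          + Cnum k r t * ((s k (n - r + 1) 0 1)%:R - t%:R * (r == n)%:R) :> rat].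
Proof.
have sum_natr m l : \sum_(j < l) Cnum k m j
    = (\sum_(j < l) first_passage k m j)%:R :> rat.
  by rewrite natr_sum; apply: eq_bigr => j _; rewrite Cnum_first_passage.
case: n n_gt0 => // n _; rewrite subn1; split.
- rewrite sum_natr -(downs_before_first_up k t (k.+1 * n.+1)) //.
  by rewrite muln0 addn0 s_path_sum.
- by split; [rewrite s_0_1 sum_natr | rewrite sum_Cnum].
case=> // r; rewrite ltnS => le_rn; rewrite subn1 subSS addn1 s_0_1 !s_path_sum.
have := downs_between_rec k t (k.+1 * n.+1) n r t t_le_k erefl le_rn.
move/(congr1 (fun x => x%:R : rat)).
rewrite -Cnum_first_passage eqSS !(natrD, natrM) /= => eqs.
by apply/eqP; rewrite mulrBr addrA -eqs; apply/eqP; ring.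
Qed.
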